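(* Let $M$ be an excluded minor for the class of quasi-graphic matroids (i.e., $M$ is not quasi-graphic but every proper minor of $M$ is). If $M$ is $9$-connected and $r(M)\le 8$, then $M$ is isomorphic to $U_{3,7}$ or $U_{4,7}$.
   Context: Graphs may have loops and parallel edges. For a graph $H$ and vertex $v$, $\mathrm{loops}_H(v)$ denotes the set of loops of $H$ at $v$. A graph $H$ is a framework for a matroid $N$ if (QG1) $E(H)=E(N)$; (QG2) $r_N(E(H'))\le |V(H')|$ for each component $H'$ of $H$; (QG3) for each vertex $v$ of $H$, $\mathrm{cl}_N(E(H-v))\subseteq E(H-v)\cup \mathrm{loops}_H(v)$; (QG4) for each circuit $C$ of $N$, the subgraph $H[C]$ has at most two components. A matroid is quasi-graphic if it has a framework. Matroid connectivity is in the sense of Tutte. *)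

(* Defs.v *)
From mathcomp Require Import all_boot.

Set Implicit Arguments.
Unset Strict Implicit.
Unset Printing Implicit Defensive.

(* The ground set is a subset of a carrier type, so that a matroid and its
   minors all have the same type. *)
Record matroid (T : finType) := Matroid {
  ground : {set T};
  indep : pred {set T};
  indep_ground : forall I, indep I -> I \subset ground;
  indep0 : indep set0;
  indepS : forall I J : {set T}, I \subset J -> indep J -> indep I;
  indep_aug : forall I J : {set T}, indep I -> indep J -> #|I| < #|J| ->
    exists2 x, x \in J :\: I & indep (x |: I) }.

Section MatroidNotions.
Variables (T : finType) (M : matroid T).
Implicit Types (X C D I J B K : {set T}).

Definition rank X : nat := \max_(I : {set T} | (I \subset X) && indep M I) #|I|.

Definition cl X : {set T} := [set e in ground M | rank (e |: X) == rank X].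

Definition circuit C : bool :=
  minset [pred X : {set T} | (X \subset ground M) && ~~ indep M X] C.

Definition basis_of_set X B : bool :=
  maxset [pred I : {set T} | (I \subset X) && indep M I] B.

Definition del_indep D : pred {set T} :=
  fun I => (I \subset ground M :\: D) && indep M I.

Definition contr_indep C : pred {set T} :=
  fun I => (I \subset ground M :\: C) &&
           [exists B : {set T}, basis_of_set C B && indep M (I :|: B)].

Lemma del_indep_ground D I : del_indep D I -> I \subset ground M :\: D.
Proof. by case/andP. Qed.

Lemma del_indep0 D : del_indep D set0.
Proof. by rewrite /del_indep sub0set indep0. Qed.

Lemma del_indepS D I J : I \subset J -> del_indep D J -> del_indep D I.
Proof.
move=> sIJ /andP[sJ iJ]; apply/andP; split; first exact: subset_trans sJ.
exact: indepS iJ.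
Qed.

Lemma del_indep_aug D I J : del_indep D I -> del_indep D J -> #|I| < #|J| ->
  exists2 x, x \in J :\: I & del_indep D (x |: I).
Proof.
move=> /andP[sI iI] /andP[sJ iJ] ltIJ.
have [x xJI ixI] := indep_aug iI iJ ltIJ; exists x => //.
rewrite /del_indep ixI andbT subUset sI andbT sub1set (subsetP sJ) //.
by case/setDP: xJI.
Qed.

Definition delete D : matroid T :=
  Matroid (@del_indep_ground D) (del_indep0 D) (@del_indepS D) (@del_indep_aug D).

Lemma basis_of_set_card X B1 B2 :
  basis_of_set X B1 -> basis_of_set X B2 -> #|B1| <= #|B2|.
Proof.
move=> /maxsetP[/= /andP[sB1 iB1] _] /maxsetP[/= /andP[sB2 iB2] mB2].
rewrite leqNgt; apply/negP => lt21.
have [x /setDP[xB1 xB2] ixB2] := indep_aug iB2 iB1 lt21.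
have : x |: B2 = B2.
  by apply: mB2; rewrite ?subsetUr //= ixB2 subUset sB2 sub1set (subsetP sB1).
by move/setP/(_ x); rewrite setU11 (negPf xB2).
Qed.

Lemma contr_indep_ground C I : contr_indep C I -> I \subset ground M :\: C.
Proof. by case/andP. Qed.

Lemma contr_indep0 C : contr_indep C set0.
Proof.
rewrite /contr_indep sub0set /=.
have p0 : [pred I : {set T} | (I \subset C) && indep M I] set0.
  by rewrite /= sub0set indep0.
have [B mB _] := maxset_exists p0; apply/existsP; exists B.
by rewrite /basis_of_set mB set0U; case/maxsetP: mB => /= /andP[].
Qed.

Lemma contr_indepS C I J : I \subset J -> contr_indep C J -> contr_indep C I.
Proof.
move=> sIJ /andP[sJ /existsP[B /andP[bB iJB]]]; apply/andP; split.
  exact: subset_trans sJ.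
by apply/existsP; exists B; rewrite bB; apply: indepS iJB; apply: setSU.
Qed.

Lemma contr_indep_aug C I J : contr_indep C I -> contr_indep C J ->
  #|I| < #|J| -> exists2 x, x \in J :\: I & contr_indep C (x |: I).
Proof.
move=> /andP[sI /existsP[B1 /andP[bB1 iIB]]] /andP[sJ /existsP[B2 /andP[bB2 iJB]]].
move=> ltIJ.
have disjB K B : K \subset ground M :\: C -> basis_of_set C B ->
    #|K :|: B| = #|K| + #|B|.
  move=> sK /maxsetP[/= /andP[sB _] _].
  suff -> : #|K :|: B| = #|K| + #|B| - 0 by rewrite subn0.
  rewrite cardsU; congr (_ - _); apply/eqP; rewrite cards_eq0 -subset0.
  apply/subsetP => y /setIP[/(subsetP sK)/setDP[_ yC] /(subsetP sB)].
  by rewrite (negPf yC).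
have ltIJB : #|I :|: B1| < #|J :|: B2|.
  rewrite (disjB _ _ sI bB1) (disjB _ _ sJ bB2) -addSn.
  by apply: leq_add ltIJ _; apply: basis_of_set_card bB1 bB2.
have [x /setDP[xJB xIB] ix] := indep_aug iIB iJB ltIJB.
move: xIB; rewrite inE negb_or => /andP[xI xB1].
move: bB1 => /[dup] bB1 /maxsetP[/= /andP[sB1 _] mB1].
have xJ : x \in J.
  case/setUP: xJB => // xB2.
  have xC : x \in C by case/maxsetP: bB2 => /= /andP[/subsetP sB2 _] _; apply: sB2.
  have E : x |: B1 = B1.
    apply: mB1; rewrite ?subsetUr //= subUset sub1set xC sB1 /=.
    by apply: indepS ix; apply: setUS; apply: subsetUr.
  by move: xB1; rewrite -E setU11.
exists x; first by rewrite inE xI.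
rewrite /contr_indep subUset sub1set (subsetP sJ) // sI /=.
by apply/existsP; exists B1; rewrite bB1 -setUA.
Qed.

Definition contract C : matroid T :=
  Matroid (@contr_indep_ground C) (contr_indep0 C) (@contr_indepS C)
          (@contr_indep_aug C).

Definition separation (k : nat) X : Prop :=
  [/\ X \subset ground M,
      k <= #|X|, k <= #|ground M :\: X|
    & rank X + rank (ground M :\: X) < rank (ground M) + k].

Definition tutte_connected (n : nat) : Prop :=
  forall k X, 0 < k < n -> ~ separation k X.

End MatroidNotions.

Definition minor (T : finType) (M : matroid T) (C D : {set T}) : matroid T :=
  delete (contract M C) D.

Definition matroid_iso (T U : finType) (M : matroid T) (N : matroid U) : Prop :=
  exists f : T -> U,
    [/\ {in ground M &, injective f}, f @: ground M = ground N
      & forall I : {set T}, I \subset ground M -> indep N (f @: I) = indep M I].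

Section Uniform.
Variables r n : nat.

Definition unif_indep : pred {set 'I_n} := fun I => #|I| <= r.

Lemma unif_indep_ground I : unif_indep I -> I \subset [set: 'I_n].
Proof. by rewrite subsetT. Qed.

Lemma unif_indep0 : unif_indep set0.
Proof. by rewrite /unif_indep cards0. Qed.

Lemma unif_indepS (I J : {set 'I_n}) :
  I \subset J -> unif_indep J -> unif_indep I.
Proof. by move/subset_leq_card; apply: leq_trans. Qed.

Lemma unif_indep_aug (I J : {set 'I_n}) : unif_indep I -> unif_indep J ->
  #|I| < #|J| -> exists2 x, x \in J :\: I & unif_indep (x |: I).
Proof.
move=> _ iJ ltIJ; have /subsetPn[x xJ xI] : ~~ (J \subset I).
  by apply/negP => /subset_leq_card; rewrite leqNgt ltIJ.
exists x; first by rewrite inE xI.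
by rewrite /unif_indep cardsU1 xI; apply: leq_trans iJ.
Qed.

Definition uniform : matroid 'I_n :=
  Matroid unif_indep_ground unif_indep0 unif_indepS unif_indep_aug.

End Uniform.

(* Loops and parallel edges are allowed: an edge is an element of T, and its
   ends form a set with one element (a loop) or two. *)
Record mgraph (V T : finType) := MGraph {
  vset : {set V};
  eset : {set T};
  ends : T -> {set V};
  endsP : forall e, e \in eset -> (ends e \subset vset) && (0 < #|ends e| <= 2) }.

Section GraphNotions.
Variables (V T : finType) (H : mgraph V T).
Implicit Types (v : V) (U : {set V}) (X : {set T}).

Definition loops v : {set T} := [set e in eset H | ends H e == [set v]].

Lemma induced_endsP U e : e \in [set e in eset H | ends H e \subset U] ->
  (ends H e \subset vset H :&: U) && (0 < #|ends H e| <= 2).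
Proof. by rewrite inE => /andP[/endsP/andP[sV ->] sU]; rewrite subsetI sV sU. Qed.

Definition induced U : mgraph V T := MGraph (@induced_endsP U).

Definition delv v : mgraph V T := induced (vset H :\ v).

Lemma edge_sub_endsP X e : e \in eset H :&: X ->
  (ends H e \subset \bigcup_(e in eset H :&: X) ends H e)
    && (0 < #|ends H e| <= 2).
Proof.
move=> eX; rewrite (bigcup_sup e) //=.
by case/setIP: eX => /endsP/andP[].
Qed.

(* H[X]: its vertices are the ends of the edges in X. *)
Definition edge_sub X : mgraph V T := MGraph (@edge_sub_endsP X).

Definition adj : rel V :=
  fun u v => [exists e in eset H, (u \in ends H e) && (v \in ends H e)].

(* Vertex sets of the components; the component itself is [induced U]. *)
Definition components : {set {set V}} :=
  equivalence_partition (connect adj) (vset H).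

End GraphNotions.

Definition framework (V T : finType) (H : mgraph V T) (N : matroid T) : Prop :=
  [/\ eset H = ground N,
      forall U, U \in components H ->
        rank N (eset (induced H U)) <= #|vset (induced H U)|,
      forall v, v \in vset H ->
        cl N (eset (delv H v)) \subset eset (delv H v) :|: loops H v
    & forall C, circuit N C -> #|components (edge_sub H C)| <= 2].

Definition quasi_graphic (T : finType) (N : matroid T) : Prop :=
  exists (V : finType) (H : mgraph V T), framework H N.

Definition excluded_minor_quasi_graphic (T : finType) (M : matroid T) : Prop :=
  ~ quasi_graphic M /\
  forall C D : {set T}, C \subset ground M -> D \subset ground M ->
    [disjoint C & D] -> C :|: D != set0 -> quasi_graphic (minor M C D).

(* Main.v *)
Require Import Defs.
From mathcomp Require Import all_boot.
From mathcomp Require Import zify.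

(* A 9-connected matroid of rank at most 8 is uniform: a set X of at most
   min(8, n/2) elements is independent with spanning complement, for otherwise
   it would give an |X|-separation.  Hence M = U_{r,n} with r = 8 and n >= 16,
   or n <= 15 and r one of the two roundings of n/2.  If n >= 8 then M has
   U_{3,7} as a proper minor, but U_{3,7} is not quasi-graphic; if n <= 6 then
   r <= 3 and M has a framework: a single vertex with loops, two vertices
   joined by parallel edges, or a triangle with at most two edges in each
   parallel class.  This leaves n = 7. *)

Set Implicit Arguments.
Unset Strict Implicit.
Unset Printing Implicit Defensive.

Lemma subset_of_card (T : finType) (A : {set T}) k :
  k <= #|A| -> exists2 B : {set T}, B \subset A & #|B| = k.
Proof.
elim: k => [|k IH] lk; first by exists set0; rewrite ?sub0set ?cards0.
have [B sB cB] := IH (ltnW lk).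
have /subsetPn[x xA xB] : ~~ (A \subset B).
  by apply/negP => /subset_leq_card; rewrite cB leqNgt lk.
by exists (x |: B); rewrite ?subUset ?sub1set ?xA // cardsU1 xB cB.
Qed.

(** * Rank, and small sets in a highly connected matroid *)

Section Rank.
Variables (T : finType) (M : matroid T).
Implicit Types X Y I : {set T}.

Lemma indep_leq_rank X I : I \subset X -> indep M I -> #|I| <= rank M X.
Proof.
by move=> sI iI; apply: (@leq_bigmax_cond _ _ (fun J : {set T} => #|J|)); apply/andP.
Qed.

Lemma rank_leP X k :
  reflect (forall I, I \subset X -> indep M I -> #|I| <= k) (rank M X <= k).
Proof.
apply: (iffP idP) => [/bigmax_leqP H I sI iI|H]; first by apply: H; rewrite sI.
by apply/bigmax_leqP => I /andP[]; apply: H.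
Qed.

Lemma rank_le_card X : rank M X <= #|X|.
Proof. by apply/rank_leP => I /subset_leq_card. Qed.

Lemma rank_mono X Y : X \subset Y -> rank M X <= rank M Y.
Proof.
move=> sXY; apply/rank_leP => I sI; apply: indep_leq_rank.
exact: subset_trans sXY.
Qed.

Lemma rank_eq_card_indep X : rank M X = #|X| -> indep M X.
Proof.
move=> rX; have : #|X| <= rank M X by rewrite rX.
have [c0|c0] := posnP #|X|.
  by move=> _; move/eqP: c0; rewrite cards_eq0 => /eqP->; apply: indep0.
apply: contraTT => nX; rewrite -ltnNge -(prednK c0) ltnS.
apply/rank_leP => I sI iI; rewrite -ltnS prednK // ltnNge; apply/negP => cI.
have /eqP E : I == X by rewrite eqEcard sI.
by rewrite -E iI in nX.
Qed.

(** Since [X] is no [#|X|]-separation, the ranks of [X] and its complement sum to at least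
    [rank M (ground M) + #|X|]; hence both attain their trivial upper bounds. *)
Lemma tutte_connected_small n X : tutte_connected M n ->
  X \subset ground M -> #|X| < n -> #|X| <= #|ground M :\: X| ->
  indep M X /\ rank M (ground M :\: X) = rank M (ground M).
Proof.
move=> con sX ltX leX.
have [c0|c0] := posnP #|X|.
  by move/eqP: c0; rewrite cards_eq0 => /eqP->; rewrite setD0 indep0.
have nsep : ~ separation M #|X| X by apply: con; rewrite c0.
have le1 := rank_le_card X.
have le2 : rank M (ground M :\: X) <= rank M (ground M).
  exact/rank_mono/subsetDl.
have : rank M (ground M) + #|X| <= rank M X + rank M (ground M :\: X).
  by rewrite leqNgt; apply/negP => lt; apply: nsep; split.
by move=> H; split; [apply: rank_eq_card_indep; lia | lia].
Qed.

End Rank.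

(** * Uniform matroids and their minors *)

(** A predicate rather than an isomorphism with [uniform r n], so that it passes directly to minors
    on the same carrier. The value [r] may exceed the size of the ground set. *)
Definition is_uniform (T : finType) r (M : matroid T) : Prop :=
  forall I : {set T}, indep M I = (I \subset ground M) && (#|I| <= r).

Section UniformTheory.
Variables (T : finType) (r : nat) (M : matroid T).
Hypothesis uM : is_uniform r M.
Implicit Types X C D I : {set T}.

Lemma rank_uniform X : X \subset ground M -> rank M X = minn #|X| r.
Proof.
move=> sX; apply/eqP; rewrite eqn_leq leq_min rank_le_card /=.
apply/andP; split; first by apply/rank_leP => I _; rewrite uM => /andP[].
have [I sI cI] := subset_of_card (geq_minl #|X| r).
rewrite -cI; apply: (indep_leq_rank sI).
by rewrite uM (subset_trans sI sX) cI geq_minr.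
Qed.

Lemma cl_uniform_small X : X \subset ground M -> #|X| < r -> cl M X \subset X.
Proof.
move=> sX lt; apply/subsetP => e; rewrite inE => /andP[eG].
rewrite !rank_uniform ?subUset ?sub1set ?eG // cardsU1.
by case: (e \in X) => //=; lia.
Qed.

Lemma cl_uniform_large X : X \subset ground M -> r <= #|X| -> ground M \subset cl M X.
Proof.
move=> sX lt; apply/subsetP => e eG; rewrite inE eG /=.
rewrite !rank_uniform ?subUset ?sub1set ?eG // cardsU1; lia.
Qed.

Lemma circuit_uniform C : C \subset ground M -> #|C| = r.+1 -> circuit M C.
Proof.
move=> sC cC; apply/minsetP; split; first by rewrite /= sC uM sC cC /= ltnn.
move=> D /= /andP[sD]; rewrite uM sD /= -ltnNge => lt sDC.
by apply/eqP; rewrite eqEcard sDC cC.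
Qed.

Lemma delete_uniform D : is_uniform r (delete M D).
Proof.
move=> I; rewrite /= /del_indep uM; have [sI|//] := boolP (I \subset ground M :\: D).
by rewrite (subset_trans sI (subsetDl _ _)).
Qed.

Lemma contract_uniform C :
  C \subset ground M -> #|C| <= r -> is_uniform (r - #|C|) (contract M C).
Proof.
move=> sC cC I; rewrite /= /contr_indep.
have [sI|//] := boolP (I \subset ground M :\: C); rewrite /=.
(* As [#|C| <= r], the set [C] is independent and thus its own only basis. *)
have basisE B : basis_of_set M C B = (B == C).
  apply/maxsetP/eqP => [[/= /andP[sB _] mB]|->].
    by apply/esym/mB; rewrite //= subxx uM sC cC.
  by split=> [|D /= /andP[sD _] sCD] /=; [rewrite subxx uM sC cC | apply/eqP; rewrite eqEsubset sD].
have cU : #|I :|: C| = #|I| + #|C|.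
  rewrite cardsU (_ : I :&: C = set0) ?cards0 ?subn0 //.
  apply/setP => x; rewrite !inE; apply/negP => /andP[/(subsetP sI)].
  by rewrite inE => /andP[/negPf->].
apply/existsP/idP => [[B /andP[]]|lI].
  by rewrite basisE uM => /eqP-> /andP[_]; rewrite cU; lia.
exists C; rewrite basisE eqxx uM cU subUset sC (subset_trans sI (subsetDl _ _)) /=.
lia.
Qed.

Lemma uniform_iso n : 0 < n -> #|ground M| = n -> matroid_iso M (uniform r n).
Proof.
(* Substituting [#|ground M|] for [n] gives [enum_rank_in] the right codomain; it also needs an
   element [x0] of the ground set. *)
move=> n0 cG; case: n / cG n0 => n0; have [x0 x0G] := card_gt0P n0.
have inj : {in ground M &, injective (enum_rank_in x0G)}.
  by move=> x y xG yG; apply: enum_rank_in_inj.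
exists (enum_rank_in x0G); split=> //.
  apply/eqP; rewrite eqEcard subsetT /= card_in_imset // cardsT card_ord.
  by [].
move=> I sI; rewrite uM sI /= /unif_indep card_in_imset //.
by move=> x y /(subsetP sI) xG /(subsetP sI) yG; apply: inj.
Qed.

End UniformTheory.

Lemma tutte_connected_uniform (T : finType) (M : matroid T) :
  tutte_connected M 9 -> rank M (ground M) <= 8 ->
  exists2 r, is_uniform r M &
    (r = 8 /\ 16 <= #|ground M|) \/
    (#|ground M| < 16 /\ (#|ground M| <= r.*2.+1 /\ r.*2 <= #|ground M|.+1)).
Proof.
move=> con le8; set G := ground M; set r := rank M G; set n := #|G|.
rewrite -/G -/r in le8.
have small (X : {set T}) : X \subset G -> #|X| <= 8 -> #|X|.*2 <= n ->
    indep M X /\ rank M (G :\: X) = r.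
  move=> sX c8 c2; apply: (tutte_connected_small con sX c8).
  rewrite cardsDS // -/G -/n; lia.
have le_r I : indep M I -> #|I| <= r.
  by move=> iI; apply: indep_leq_rank (indep_ground iI) iI.
(* [h] is the largest size to which [small] applies. A set of this size gives [h <= r] by
   independence and [r <= n - h] by its spanning complement. *)
have [h [h8 h2 hmax]] : exists h, [/\ h <= 8, h.*2 <= n &
    (h = 8 /\ 16 <= n) \/ (n < 16 /\ n <= h.*2.+1)].
  by exists (minn 8 n./2); split; lia.
have [X sX cX] : exists2 X : {set T}, X \subset G & #|X| = h.
  by apply: subset_of_card; lia.
have [|| iX rX] := small X sX; rewrite ?cX //.
have lehr : h <= r by rewrite -cX; apply: le_r.
have lern : r <= n - h.
  rewrite -rX -cX -(cardsDS sX); exact: rank_le_card.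
exists r; last by rewrite -/n; lia.
move=> I; apply/idP/andP => [iI|[sI cI]].
  by rewrite (indep_ground iI) le_r.
have [leIh|ltIh] := leqP #|I| h; first by apply: (small I sI _ _).1; lia.
(* Now [h < r], so [n < 16] and [r <= n - h <= h + 1]. Hence [#|I| = r = h + 1], and [I] is the
   complement of a set of at most [h] elements, so it spans. *)
have [||_ rI] := small (G :\: I) (subsetDl _ _); rewrite ?cardsDS //; try lia.
apply: rank_eq_card_indep; move: rI; rewrite setDDr setDv set0U (setIidPr sI).
lia.
Qed.

(** * Counting components of a multigraph *)

Section Graph.
Variables (V T : finType) (H : mgraph V T).

Lemma adj_sym : symmetric (adj H).
Proof. by move=> x y; apply: eq_existsb => e; rewrite (andbC (x \in _)). Qed.

Lemma connect_adj_sym : connect_sym (adj H).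
Proof. by apply: sym_connect_sym; apply: adj_sym. Qed.

Lemma adj_edge e x y : e \in eset H -> x \in ends H e -> y \in ends H e -> adj H x y.
Proof. by move=> eE xe ye; apply/existsP; exists e; rewrite eE xe ye. Qed.

Lemma component_of x : x \in vset H ->
  [set y in vset H | connect (adj H) x y] \in components H.
Proof. by move=> xV; apply/imsetP; exists x. Qed.

Lemma card_components_le : #|components H| <= #|vset H|.
Proof. exact: leq_imset_card. Qed.

(** The map from vertices to components identifies [x] and [y], so it is not injective. *)
Lemma card_components_lt x y : x \in vset H -> y \in vset H -> x != y ->
  adj H x y -> #|components H| < #|vset H|.
Proof.
move=> xV yV neq axy; rewrite ltn_neqAle card_components_le andbT.
apply/negP => /imset_injP inj; case/eqP: neq; apply: inj => //.
apply/setP => z; rewrite !inE; congr (_ && _).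
exact: (same_connect connect_adj_sym (connect1 axy)).
Qed.

Lemma connect_adj_closed (U : {set V}) x y :
  (forall u v, u \in U -> adj H u v -> v \in U) ->
  x \in U -> connect (adj H) x y -> y \in U.
Proof.
move=> clU xU /connectP[p pth ->]; elim: p x xU pth => //= z p IH x xU /andP[axz].
by apply: IH; apply: clU axz.
Qed.

Lemma card_components_loops :
  (forall e, e \in eset H -> #|ends H e| = 1) -> #|components H| = #|vset H|.
Proof.
move=> lp; apply/eqP/imset_injP => x y xV yV /setP/(_ x).
rewrite !inE xV connect0 /= => /esym cyx; apply/eqP; rewrite -in_set1.
apply: connect_adj_closed cyx; last by rewrite inE.
move=> u v; rewrite !inE => /eqP-> /existsP[e /and3P[/lp/eqP/cards1P[w ->]]].
by rewrite !inE => /eqP-> /eqP->.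
Qed.

End Graph.

(* By (QG3) at most two edges avoid a vertex that meets a non-loop edge.  Hence a
   non-loop edge uv has a parallel class of at least 3 edges, so that {u, v} is
   a component, of rank 3, against (QG2).  If every edge is a loop, (QG2) makes
   them lie at distinct vertices, so a 4-element circuit has 4 components. *)
Lemma uniform37_not_quasi_graphic (T : finType) (N : matroid T) :
  is_uniform 3 N -> #|ground N| = 7 -> ~ quasi_graphic N.
Proof.
move=> uN cN [V [H [EH QG2 QG3 QG4]]].
have subG (P : pred T) : [set e in eset H | P e] \subset ground N.
  by rewrite -EH; apply/subsetP => e; rewrite inE => /andP[].
have nonloop e x : e \in eset H -> x \in ends H e -> ends H e != [set x] ->
    #|eset (delv H x)| <= 2.
  (* Three edges avoiding [x] would span [N], and (QG3) would make [e] avoid [x] or be a loop at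
     [x]. *)
  move=> eE xe nl; rewrite leqNgt; apply/negP => lt.
  have xV : x \in vset H by case/andP: (endsP eE) => /subsetP/(_ x xe).
  have := subsetP (cl_uniform_large uN (subG _) lt) e.
  rewrite -EH => /(_ eE)/(subsetP (QG3 x xV)); rewrite !inE eE (negPf nl) /= orbF.
  by move/subsetP/(_ x xe); rewrite !inE eqxx.
have [e /andP[eE ne1]|allloops] := pickP (fun e => (e \in eset H) && (#|ends H e| != 1)).
  have c2 : #|ends H e| == 2 by have /and3P[_] := endsP eE; lia.
  have [u [v [neq uv]]] := cards2P _ c2.
  have nlu : ends H e != [set u].
    by apply: contra ne1 => /eqP->; rewrite cards1.
  have nlv : ends H e != [set v].
    by apply: contra ne1 => /eqP->; rewrite cards1.
  have sV : ends H e \subset vset H by case/andP: (endsP eE).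
  have uV : u \in vset H by rewrite (subsetP sV) // uv !inE eqxx.
  have leu : #|eset (delv H u)| <= 2 by apply: (nonloop e); rewrite // uv !inE eqxx.
  have lev : #|eset (delv H v)| <= 2.
    by apply: (nonloop e); rewrite // uv !inE eqxx orbT.
  pose P := [set f in eset H | ends H f == [set u; v]].
  (* Of the 7 edges, at most 2 avoid [u] and at most 2 avoid [v]; the others join [u] to [v]. *)
  have P3 : 3 <= #|P|.
    have cover : eset H \subset P :|: (eset (delv H u) :|: eset (delv H v)).
      apply/subsetP => f fE; rewrite !inE fE /=.
      have /and3P[sf _ f2] := endsP fE.
      have avoid x : x \notin ends H f -> ends H f \subset vset H :\ x.
        by move=> xf; rewrite subsetD1 sf.
      have [uf|/avoid->] := boolP (u \in ends H f); last by rewrite orbT.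
      have [vf|/avoid->] := boolP (v \in ends H f); last by rewrite !orbT.
      suff -> : ends H f = [set u; v] by rewrite eqxx.
      by apply/esym/eqP; rewrite eqEcard subUset !sub1set uf vf cards2 neq.
    move/subset_leq_card: cover; rewrite EH cN => le7.
    have := leq_trans le7 (leq_card_setU _ _).1.
    have := leq_of_leqif (leq_card_setU (eset (delv H u)) (eset (delv H v))).
    lia.
  (* A neighbour [y] outside would meet a non-loop edge, yet the three edges of [P] avoid it. *)
  have closed_uv x y : x \in [set u; v] -> adj H x y -> y \in [set u; v].
    move=> xuv /existsP[f /and3P[fE xf yf]]; apply/negPn/negP => yuv.
    have nly : ends H f != [set y].
      by apply: contraNneq yuv => E; move: xf; rewrite E inE => /eqP<-.
    have := nonloop f y fE yf nly; rewrite leqNgt => /negP; apply.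
    apply: leq_trans P3 (subset_leq_card _); apply/subsetP => g.
    rewrite !inE => /andP[gE /eqP gE2]; rewrite gE gE2 subsetD1 yuv andbT -uv.
    exact: sV.
  have := QG2 _ (component_of uV); set U := [set y in _ | _] => leU.
  have sU : U \subset [set u; v].
    apply/subsetP => y /setIdP[_].
    by apply: connect_adj_closed closed_uv _; rewrite !inE eqxx.
  have sPU : P \subset eset (induced H U).
    apply/subsetP => g; rewrite !inE => /andP[gE /eqP->]; rewrite gE /=.
    apply/subsetP => y yuv; rewrite inE (subsetP sV) ?uv //=.
    by apply/connect1/(adj_edge eE); rewrite uv // !inE eqxx.
  move: leU; rewrite (rank_uniform uN (subG _)).
  have := subset_leq_card sPU.
  have := subset_leq_card (subset_trans (subsetIr (vset H) U) sU).
  rewrite cards2 neq /=; lia.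
have lp e : e \in eset H -> #|ends H e| = 1.
  by move=> eE; have := allloops e; rewrite eE => /negbFE/eqP.
have loops1 v : v \in vset H -> #|loops H v| <= 1.
  move=> vV; have := QG2 _ (component_of vV); set U := [set y in _ | _] => leU.
  have sU : U \subset [set v].
    apply/subsetP => y /setIdP[_].
    apply: connect_adj_closed; last by rewrite inE.
    move=> x z; rewrite !inE => /eqP-> /existsP[e /and3P[/lp/eqP/cards1P[w ->]]].
    by rewrite !inE => /eqP-> /eqP->.
  have sL : loops H v \subset eset (induced H U).
    apply/subsetP => g; rewrite !inE => /andP[gE /eqP->]; rewrite gE /=.
    by rewrite sub1set inE vV connect0.
  move: leU; rewrite (rank_uniform uN (subG _)).
  have := subset_leq_card sL.
  have := subset_leq_card (subset_trans (subsetIr (vset H) U) sU).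
  rewrite cards1 /=; lia.
have inj : {in eset H &, injective (ends H)}.
  move=> e f eE fE eqef; have /cards1P[v ev] : #|ends H e| == 1 by rewrite lp.
  have vV : v \in vset H.
    by have /andP[/subsetP sV _] := endsP eE; rewrite sV // ev inE.
  apply: (card_le1_eqP (loops1 v vV)); rewrite inE ?eE ?fE -?eqef ev; exact: eqxx.
have [C sC cC] : exists2 C : {set T}, C \subset ground N & #|C| = 4.
  by apply: subset_of_card; rewrite cN.
have := QG4 C (circuit_uniform uN sC cC).
rewrite card_components_loops; last by move=> e /setIP[/lp].
suff : 4 <= #|vset (edge_sub H C)| by lia.
have <- : #|ends H @: C| = 4.
  rewrite card_in_imset // => x y xC yC; apply: inj; rewrite EH; exact: (subsetP sC).
(* End sets of loops are singletons, so they are counted through the image of the vertices under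
   [set1]. *)
apply: leq_trans (leq_imset_card set1 _); apply/subset_leq_card/subsetP => _ /imsetP[e eC ->].
have eE : e \in eset H by rewrite EH (subsetP sC).
have /cards1P[v ev] : #|ends H e| == 1 by rewrite lp.
apply/imsetP; exists v => //; apply/bigcupP; exists e; first by rewrite inE eE.
by rewrite ev inE.
Qed.

(** * Frameworks for small uniform matroids *)

Section SmallUniform.
Variables (T : finType) (M : matroid T).

Lemma uniform1_quasi_graphic r : is_uniform r M -> r <= 1 -> quasi_graphic M.
Proof.
move=> uM r1.
have eP (e : T) : e \in ground M ->
    ([set tt] \subset [set: unit]) && (0 < #|[set tt]| <= 2).
  by rewrite subsetT cards1.
exists unit, (MGraph eP); split=> //= [U|v _|C _].
- case/imsetP=> -[] _ ->; rewrite (rank_uniform uM); last first.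
    by apply/subsetP => e; rewrite inE => /andP[].
  rewrite (leq_trans (geq_minr _ _)) // (leq_trans r1) //.
  by apply/card_gt0P; exists tt; rewrite !inE connect0.
- apply/subsetP => e; rewrite !inE => /andP[-> _] /=.
  by apply/orP; right; apply/eqP/setP => -[]; case: v; rewrite !inE.
- by rewrite (leq_trans (card_components_le _)) // (leq_trans (max_card _)) // card_unit.
Qed.

Lemma uniform2_quasi_graphic : is_uniform 2 M -> quasi_graphic M.
Proof.
move=> uM.
have eP (e : T) : e \in ground M ->
    ([set: bool] \subset [set: bool]) && (0 < #|[set: bool]| <= 2).
  by rewrite subsetT cardsT card_bool.
exists bool, (MGraph eP); split=> //= [U _|v _|C _].
- rewrite (rank_uniform uM); last by apply/subsetP => e; rewrite inE => /andP[].
  (* The bound holds for every vertex set [U]: unless it contains both vertices, it induces no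
     edge. *)
  rewrite setTI; have [sU|_] := boolP ([set: bool] \subset U).
    rewrite (leq_trans (geq_minr _ _)) // (leq_trans _ (subset_leq_card sU)) //.
    by rewrite cardsT card_bool.
  set A := [set _ in _ | _]; suff -> : A = set0 by rewrite cards0.
  by apply/setP => e; rewrite !inE andbF.
- set A := [set _ in _ | _]; have A0 : A = set0.
    apply/setP => e; rewrite !inE; apply/negP => /andP[_ /subsetP/(_ v)].
    by rewrite !inE eqxx => /(_ isT).
  by apply: subset_trans (subsetUl _ _); apply: (cl_uniform_small uM); rewrite A0 ?sub0set ?cards0.
- by rewrite (leq_trans (card_components_le _)) // (leq_trans (max_card _)) // card_bool.
Qed.

(** Pair consecutive elements of [enum G]: positions below 6, halved, are below 3, so [inord] does
    not fall back to its default on [G]. *)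
Lemma small_fibers3 (G : {set T}) : #|G| <= 6 ->
  exists f : T -> 'I_3, forall i, #|[set e in G | f e == i]| <= 2.
Proof.
move=> c6; exists (fun e => inord (index e (enum G) %/ 2)) => i.
set F := [set _ in _ | _]; have [->|[x0 _]] := set_0Vmem F; first by rewrite cards0.
have sF : F \subset [set nth x0 (enum G) i.*2; nth x0 (enum G) i.*2.+1].
  apply/subsetP => e; rewrite inE => /andP[eG /eqP/(congr1 val)] /=.
  have lt : index e (enum G) < #|G| by rewrite cardE index_mem mem_enum.
  rewrite inordK => [Ei|]; last by lia.
  have Ee : nth x0 (enum G) (index e (enum G)) = e by rewrite nth_index ?mem_enum.
  have [E|E] : index e (enum G) = i.*2 \/ index e (enum G) = i.*2.+1 by lia.
    by rewrite !inE -E Ee eqxx.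
  by rewrite !inE -E Ee eqxx orbT.
apply: leq_trans (subset_leq_card sF) _; rewrite cards2; by case: (_ != _).
Qed.

(** The edge [e] joins the two vertices other than [f e], so the fibres of [f] are the parallel
    classes of the triangle. Edges avoiding a vertex lie in one fibre: there are at most two, too
    few to span anything further. *)
Lemma uniform3_quasi_graphic : is_uniform 3 M -> #|ground M| <= 6 -> quasi_graphic M.
Proof.
move=> uM c6; have [f f2] := small_fibers3 c6.
have c2 (i : 'I_3) : #|[set~ i]| = 2 by rewrite cardsC1 card_ord.
have eP (e : T) : e \in ground M ->
    ([set~ f e] \subset [set: 'I_3]) && (0 < #|[set~ f e]| <= 2).
  by rewrite subsetT c2.
have miss (U : {set 'I_3}) w : w \notin U ->
    [set e in ground M | [set~ f e] \subset U] \subset [set e in ground M | f e == w].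
  move=> wU; apply/subsetP => e; rewrite !inE => /andP[-> /subsetP/(_ w) sU] /=.
  by apply: contraR wU => ne; apply: sU; rewrite !inE eq_sym.
exists 'I_3, (MGraph eP); split=> //= [U _|v _|C _].
- set A := [set _ in _ | _]; have sA : A \subset ground M.
    by apply/subsetP => e; rewrite inE => /andP[].
  rewrite (rank_uniform uM sA) setTI; have [lt|] := ltnP #|U| 2.
    have -> : A = set0; last by rewrite cards0.
    apply/setP => e; rewrite !inE; apply/negP => /andP[_ /subset_leq_card].
    by rewrite c2; lia.
  have [sU|/subsetPn[w _ wU]] := boolP ([set: 'I_3] \subset U).
    rewrite (leq_trans (geq_minr _ _)) // (leq_trans _ (subset_leq_card sU)) //.
    by rewrite cardsT card_ord.
  apply: leq_trans; rewrite (leq_trans (geq_minl _ _)) //.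
  exact: leq_trans (subset_leq_card (miss U w wU)) (f2 w).
- apply: subset_trans (subsetUl _ _); apply: (cl_uniform_small uM).
    by apply/subsetP => e; rewrite inE => /andP[].
  rewrite ltnS (leq_trans _ (f2 v)) // subset_leq_card // miss //.
  by rewrite !inE eqxx.
(* For (QG4), any edge of [K] joins two distinct vertices, so [K] has fewer components than its at
   most 3 vertices. *)
- set K := edge_sub _ C; have leV : #|vset K| <= 3.
    by rewrite (leq_trans (max_card _)) // card_ord.
  have [V0|[x xV]] := set_0Vmem (vset K).
    by rewrite (leq_trans (card_components_le _)) // V0 cards0.
  have /bigcupP[e eC xe] := xV.
  have /subsetPn[y ye yx] : ~~ ([set~ f e] \subset [set x]).
    by apply/negP => /subset_leq_card; rewrite c2 cards1.
  have yV : y \in vset K by apply/bigcupP; exists e.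
  have axy : adj K x y by apply: (@adj_edge _ _ K e).
  rewrite -ltnS; apply: leq_trans leV; apply: card_components_lt axy => //.
  by rewrite eq_sym -in_set1.
Qed.

End SmallUniform.

Theorem theorem3p3 (T : finType) (M : matroid T)
  (hM : excluded_minor_quasi_graphic M)
  (hconn : tutte_connected M 9)
  (hrank : rank M (ground M) <= 8) :
  matroid_iso M (uniform 3 7) \/ matroid_iso M (uniform 4 7).
Proof.
have [r uM rn] := tutte_connected_uniform hconn hrank; have [nqM qmin] := hM.
have [n8|n8] := leqP 8 #|ground M|.
  (* With at least 8 elements, [r >= 4] and [#|ground M| - r >= 4]: contracting [r - 3] elements
     leaves rank 3 and at least 7 elements. *)
  have [C sC cC] : exists2 C : {set T}, C \subset ground M & #|C| = r - 3.
    by apply: subset_of_card; lia.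
  have cGC : #|ground M :\: C| = #|ground M| - (r - 3) by rewrite cardsDS ?cC.
  have [D sD cD] : exists2 D : {set T}, D \subset ground M :\: C &
      #|D| = #|ground M :\: C| - 7 by apply: subset_of_card; lia.
  case: (@uniform37_not_quasi_graphic _ (minor M C D)).
  - apply: delete_uniform; have -> : 3 = r - #|C| by lia.
    by apply: contract_uniform => //; lia.
  - by rewrite /= cardsDS // cD; lia.
  - apply: qmin => //; first exact: subset_trans sD (subsetDl _ _).
      by rewrite disjoint_sym; move: sD; rewrite subsetD => /andP[].
    (* The minor is proper: 7 elements remain out of at least 8. *)
    apply/negP => /eqP E; have := subset_leq_card (subsetUl C D).
    have := subset_leq_card (subsetUr C D).
    rewrite E cards0; lia.
have [n7|n6] : #|ground M| = 7 \/ #|ground M| <= 6 by lia.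
  have [r3|r4] : r = 3 \/ r = 4 by lia.
    by left; apply: uniform_iso n7; rewrite // -r3.
  by right; apply: uniform_iso n7; rewrite // -r4.
(* At most 6 elements give [r.*2 <= 7], hence [r <= 3]. *)
case: nqM; have [r1|r2] := leqP r 1; first exact: uniform1_quasi_graphic uM r1.
have [r2'|r3] : r = 2 \/ r = 3 by lia.
  by apply: uniform2_quasi_graphic; rewrite -r2'.
by rewrite r3 in uM; apply: uniform3_quasi_graphic.
Qed.
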